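(* Let ${\cal O}$ be the union of some of the sets $A^mB^n$, including $A$ and $B$. Then, the set $Q^{\cal O}$ of ${\cal O}$-positive distributions is closed under wirings.
   Context: Bipartite Bell scenario: Alice (Bob) feeds an input $x$ ($y$) from a finite alphabet and receives an output $a$ ($b$) from a finite alphabet; a box is a no-signalling distribution $P(a,b|x,y)$. Assign symbolic projectors $E^x_a$ (Alice) and $F^y_b$ (Bob) to each local event $(x,a)$, $(y,b)$; $A$ and $B$ denote the sets of Alice's and Bob's projectors. They can be conjugated and multiplied formally, every $F$ commutes with every $E$, and a product of two consecutive projectors corresponding to different outcomes of the same measurement equals 0. $A^mB^n$ denotes the set of all products $E^{x_1}_{a_1}\cdots E^{x_{m'}}_{a_{m'}}F^{y_1}_{b_1}\cdots F^{y_{n'}}_{b_{n'}}$ with $m'\leq m$, $n'\leq n$ (taking $m'=n'=0$ gives the identity $1$). ${\cal O}$ is a (symmetric) union of sets of this type containing $A$ and $B$; $\overline{{\cal O}}$ is the real span of ${\cal O}$ and $\overline{{\cal O}}^2$ the real span of products of two elements of ${\cal O}$. A no-signalling distribution $P(a,b|x,y)$ is ${\cal O}$-positive if there exists a linear functional $L:\overline{{\cal O}}^2\to\mathbb{R}$ with $L(1)=1$, $L(ff^\dagger)\geq 0$ for all $f\in\overline{{\cal O}}$, and $P(a,b|x,y)=L(E^x_aF^y_b)$. A set of boxes is closed under wirings if, for any finite collection of boxes from the set and any pair of local wirings (each party sequentially chooses which of its local boxes to probe and with which input as a function of its effective input and previously obtained outputs, and then post-processes the obtained outputs into an effective output), the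 resulting effective box belongs to the set. *)

(* Defs.v *)
From HB Require Import structures.
From mathcomp Require Import all_boot all_order all_algebra.
From mathcomp Require Import reals.
Set Implicit Arguments. Unset Strict Implicit. Unset Printing Implicit Defensive.
Import Order.TTheory GRing.Theory Num.Theory.
Local Open Scope ring_scope.

Section Bell.
Variable R : realType.

(* Boxes in the Bell scenario with input alphabets X (Alice), Y (Bob)  *)
(* and output alphabets A (Alice), B (Bob).  P x y a b = P(a,b|x,y).   *)
Section Box.
Variables (X A Y B : finType).

Definition is_box (P : X -> Y -> A -> B -> R) : Prop :=
  [/\ (0 < #|X|)%N, (0 < #|Y|)%N & (forall x y a b, 0 <= P x y a b)] /\
  [/\
      (forall x y, \sum_(a : A) \sum_(b : B) P x y a b = 1),
      (forall x y y' a, \sum_(b : B) P x y a b = \sum_(b : B) P x y' a b) &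
      (forall x x' y b, \sum_(a : A) P x y a b = \sum_(a : A) P x' y a b)].

(* marginals (well defined by no-signalling; averaged over the other input) *)
Definition margA (P : X -> Y -> A -> B -> R) (x : X) (a : A) : R :=
  (#|Y|%:R)^-1 * \sum_(y : Y) \sum_(b : B) P x y a b.
Definition margB (P : X -> Y -> A -> B -> R) (y : Y) (b : B) : R :=
  (#|X|%:R)^-1 * \sum_(x : X) \sum_(a : A) P x y a b.

(* Symbolic projectors: letter inl (x,a) is E^x_a, inr (y,b) is F^y_b. *)
(* Monomials are words; elements of the free real algebra are formal   *)
(* finite linear combinations of words.                                *)
Definition letter : Type := ((X * A) + (Y * B))%type.
Definition word : Type := seq letter.
Definition fsum : Type := seq (R * word).

Definition coef (p : fsum) (w : word) : R := \sum_(t <- p | t.2 == w) t.1.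

Definition is_relator (r : fsum) : Prop :=
  (exists (e : X * A) (f : Y * B),
      r = [:: (1, [:: inl e; inr f]); (-1, [:: inr f; inl e])]) \/
  (exists l : letter, r = [:: (1, [:: l; l]); (-1, [:: l])]) \/
  (exists (x : X) (a a' : A), a != a' /\ r = [:: (1, [:: inl (x, a); inl (x, a')])]) \/
  (exists (y : Y) (b b' : B), b != b' /\ r = [:: (1, [:: inr (y, b); inr (y, b')])]).

(* the element  sum_i c_i u_i r_i v_i  of the two-sided ideal *)
Definition ideal_sum (ts : seq (R * word * fsum * word)) : fsum :=
  flatten [seq [seq (t.1.1.1 * d.1, t.1.1.2 ++ d.2 ++ t.2) | d <- t.1.2] | t <- ts].

Definition in_ideal (p : fsum) : Prop :=
  exists ts : seq (R * word * fsum * word),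
    (forall t, t \in ts -> is_relator t.1.2) /\
    (forall w, coef p w = coef (ideal_sum ts) w).

(* the conjugate of a word (projectors are self-adjoint) *)
Definition conjw (w : word) : word := rev w.

Definition in_AmBn (m n : nat) (w : word) : Prop :=
  exists (u : seq (X * A)) (v : seq (Y * B)),
    [/\ (size u <= m)%N, (size v <= n)%N & w = map inl u ++ map inr v].

Definition in_O (Ob : nat -> nat -> Prop) (w : word) : Prop :=
  exists m n, Ob m n /\ in_AmBn m n w.

(* words spanning \bar O^2 = span { o o'^dagger : o, o' in O }
   (= span { o o' } because O is symmetric) *)
Definition in_O2 (Ob : nat -> nat -> Prop) (w : word) : Prop :=
  exists u v, [/\ in_O Ob u, in_O Ob v & w = u ++ conjw v].

Definition evalL (L : word -> R) (p : fsum) : R := \sum_(t <- p) t.1 * L t.2.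

(* O-positivity: there is a linear functional L on \bar O^2 (an element
   of the quotient algebra), i.e. a function on the spanning words of
   \bar O^2 vanishing on every element of the ideal supported on them,
   with L(1) = 1, L(f f^dagger) >= 0 for f in \bar O and
   P(a,b|x,y) = L(E^x_a F^y_b). *)
Definition O_positive (Ob : nat -> nat -> Prop) (P : X -> Y -> A -> B -> R) : Prop :=
  is_box P /\
  exists L : word -> R,
    [/\ (forall p : fsum, in_ideal p ->
            (forall w, coef p w != 0 -> in_O2 Ob w) -> evalL L p = 0),
        L [::] = 1,
        (forall f : seq (R * word), (forall t, t \in f -> in_O Ob t.2) ->
            0 <= \sum_(s <- f) \sum_(t <- f) s.1 * t.1 * L (s.2 ++ conjw t.2)) &
        (forall x y a b, P x y a b = L [:: inl (x, a); inr (y, b)])].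

End Box.

(* A collection of K boxes; box k has alphabets X k, A k (Alice) and   *)
(* Y k, B k (Bob).  A local wiring of one party, for a fixed effective *)
(* input, is a finite decision tree: at each node it probes a box k    *)
(* with an input (depending on previously obtained outputs); at the    *)
(* leaves it outputs the effective output.                             *)
Section Wiring.
Variable K : nat.

Inductive strat (I O : 'I_K -> finType) (Out : Type) : Type :=
| Leaf of Out
| Probe (k : 'I_K) of I k & (O k -> strat I O Out).

Arguments Leaf {I O Out}.
Arguments Probe {I O Out}.

Fixpoint once_from {I O : 'I_K -> finType} {Out : Type}
    (t : strat I O Out) (used : seq 'I_K) : Prop :=
  match t with
  | Leaf _ => True
  | Probe k _ c => k \notin used /\ forall o, once_from (c o) (k :: used)
  end.
Definition once {I O : 'I_K -> finType} {Out : Type} (t : strat I O Out) :=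
  once_from t [::].

Fixpoint result {I O : 'I_K -> finType} {Out : Type}
    (t : strat I O Out) (o : forall k, O k) : Out :=
  match t with
  | Leaf r => r
  | Probe k _ c => result (c (o k)) o
  end.

Fixpoint input {I O : 'I_K -> finType} {Out : Type}
    (t : strat I O Out) (o : forall k, O k) (k : 'I_K) : option (I k) :=
  match t with
  | Leaf _ => None
  | Probe k' i c =>
      if k' =P k is ReflectT e then Some (eq_rect k' (fun j => (I j : Type)) i k e)
      else input (c (o k')) o k
  end.

Variables (X A Y B : 'I_K -> finType).
Variable (P : forall k, X k -> Y k -> A k -> B k -> R).

(* weight of the joint output assignment (a, b) of all boxes; outputs of
   boxes that a party does not probe are irrelevant and are filled in
   uniformly at random (this does not affect the effective box) *)
Definition box_weight (k : 'I_K) (ik : option (X k)) (jk : option (Y k))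
    (a : A k) (b : B k) : R :=
  match ik, jk with
  | Some x, Some y => @P k x y a b
  | Some x, None => margA (@P k) x a / #|B k|%:R
  | None, Some y => margB (@P k) y b / #|A k|%:R
  | None, None => (#|A k|%:R * #|B k|%:R)^-1
  end.

Variables (X' A' Y' B' : finType).

Definition wired (TA : X' -> strat X A A') (TB : Y' -> strat Y B B')
    (x' : X') (y' : Y') (a' : A') (b' : B') : R :=
  \sum_(a : {dffun forall k, A k}) \sum_(b : {dffun forall k, B k})
    if (result (TA x') a == a') && (result (TB y') b == b') then
      \prod_(k : 'I_K) box_weight (input (TA x') a k) (input (TB y') b k) (a k) (b k)
    else 0.

End Wiring.

Arguments Leaf {K I O Out}.
Arguments Probe {K I O Out}.

Definition closed_under_wirings
    (S : forall X A Y B : finType, (X -> Y -> A -> B -> R) -> Prop) : Prop :=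
  forall (K : nat) (X A Y B : 'I_K -> finType)
         (P : forall k, X k -> Y k -> A k -> B k -> R),
    (forall k, S (X k) (A k) (Y k) (B k) (P k)) ->
    forall (X' A' Y' B' : finType), (0 < #|X'|)%N -> (0 < #|Y'|)%N ->
    forall (TA : X' -> strat X A A') (TB : Y' -> strat Y B B'),
      (forall x', once (TA x')) -> (forall y', once (TB y')) ->
      S X' A' Y' B' (wired P TA TB).

End Bell.

(* Main.v *)
Require Import Defs.
From mathcomp Require Import all_boot all_order all_algebra.
From mathcomp Require Import boolp reals ring lra.
Set Implicit Arguments. Unset Strict Implicit. Unset Printing Implicit Defensive.
Import Order.TTheory GRing.Theory Num.Theory.
Local Open Scope ring_scope.

(* An O-positive functional extends to the whole word algebra modulo the ideal and,
   averaged with its image under conjugation, becomes a function M(u, v) of a word u in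
   Alice's projectors and a word v in Bob's whose moment kernel is symmetric and positive
   semidefinite.  Assign to each effective event of a wiring the sum, over the leaves of
   the decision tree that produce it, of the tensor products of the projectors met on the
   way.  Since no box is probed twice along a branch, these sums satisfy the projector
   relations, and a product of m of them only involves products of at most m projectors
   of each box.  The tensor product of the functionals of the boxes therefore induces a
   functional for the wired box, and it is positive by the Schur product theorem. *)

(** * Positive semidefinite kernels *)

Definition symmetric_kernel (T V : Type) (G : T -> T -> V) : Prop :=
  forall s t, G s t = G t s.

Section FormalSums.
Variables (R : comPzRingType) (T : eqType).
Implicit Types (f g : seq (R * T)) (G : T -> T -> R) (D : T -> Prop).

Definition supported_on D f : Prop := forall t, t \in f -> D t.2.

Definition scale (c : R) f : seq (R * T) := [seq (c * t.1, t.2) | t <- f].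

Definition inner G f g : R := \sum_(s <- f) \sum_(t <- g) s.1 * t.1 * G s.2 t.2.

Lemma supported_on_seq1 D c x : D x -> supported_on D [:: (c, x)].
Proof. by move=> Dx t; rewrite inE => /eqP->. Qed.

Lemma supported_on_cat D f g :
  supported_on D f -> supported_on D g -> supported_on D (f ++ g).
Proof. by move=> Df Dg t; rewrite mem_cat => /orP[/Df|/Dg]. Qed.

Lemma supported_on_scale D c f : supported_on D f -> supported_on D (scale c f).
Proof. by move=> Df _ /mapP[t /Df Dt ->]. Qed.

Lemma inner_seq1 G c d x y : inner G [:: (c, x)] [:: (d, y)] = c * d * G x y.
Proof. by rewrite /inner !big_seq1. Qed.

Lemma inner_catl G f f' g : inner G (f ++ f') g = inner G f g + inner G f' g.
Proof. by rewrite /inner big_cat. Qed.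

Lemma inner_catr G f g g' : inner G f (g ++ g') = inner G f g + inner G f g'.
Proof. by rewrite /inner -big_split; apply: eq_bigr => s _; rewrite big_cat. Qed.

Lemma inner_scalel G c f g : inner G (scale c f) g = c * inner G f g.
Proof.
rewrite /inner big_map mulr_sumr; apply: eq_bigr => s _.
by rewrite mulr_sumr; apply: eq_bigr => t _; rewrite !mulrA.
Qed.

Lemma innerC G f g : inner G f g = inner (fun s t => G t s) g f.
Proof.
rewrite /inner exchange_big; apply: eq_bigr => t _; apply: eq_bigr => s _.
by rewrite [s.1 * _]mulrC.
Qed.

Lemma inner_scaler G c f g : inner G f (scale c g) = c * inner G f g.
Proof. by rewrite innerC inner_scalel -innerC. Qed.

Lemma eq_inner G H f g : G =2 H -> inner G f g = inner H f g.
Proof. by move=> GH; rewrite /inner; do 2![apply: eq_bigr => ? _]; rewrite GH. Qed.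

Lemma inner_sym G f g : symmetric_kernel G -> inner G f g = inner G g f.
Proof. by move=> symG; rewrite innerC; apply: eq_inner. Qed.

Lemma innerDr G H f g : inner (fun s t => G s t + H s t) f g = inner G f g + inner H f g.
Proof.
rewrite /inner -big_split; apply: eq_bigr => s _.
by rewrite -big_split; apply: eq_bigr => t _; rewrite mulrDr.
Qed.

Lemma innerZr c G f g : inner (fun s t => c * G s t) f g = c * inner G f g.
Proof.
rewrite /inner mulr_sumr; apply: eq_bigr => s _.
by rewrite mulr_sumr; apply: eq_bigr => t _; rewrite mulrCA.
Qed.

Lemma inner_rank1 (u : T -> R) f :
  inner (fun s t => u s * u t) f f = (\sum_(t <- f) t.1 * u t.2) ^+ 2.
Proof.
rewrite expr2 mulr_suml; apply: eq_bigr => s _.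
by rewrite mulr_sumr; apply: eq_bigr => t _; rewrite mulrACA.
Qed.

End FormalSums.

Lemma inner_map (R : comPzRingType) (S T : eqType) (h : S -> T) (G : T -> T -> R)
    (f : seq (R * S)) :
  inner (fun s t => G (h s) (h t)) f f =
  inner G [seq (t.1, h t.2) | t <- f] [seq (t.1, h t.2) | t <- f].
Proof. by rewrite /inner big_map; apply: eq_bigr => s _; rewrite big_map. Qed.

Definition psd_on (R : numDomainType) (T : eqType) (D : T -> Prop)
    (G : T -> T -> R) : Prop :=
  forall f, supported_on D f -> 0 <= inner G f f.

Section PsdClosure.
Variables (R : numDomainType) (T : eqType).
Implicit Types (G H : T -> T -> R) (D : T -> Prop).

Lemma sub_psd_on D D' G : (forall t, D' t -> D t) -> psd_on D G -> psd_on D' G.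
Proof. by move=> sD psdG f Df; apply: psdG => t /Df/sD. Qed.

Lemma eq_psd_on D G H : (forall s t, D s -> D t -> G s t = H s t) ->
  psd_on D G -> psd_on D H.
Proof.
move=> GH psdG f Df; have := psdG f Df; congr (_ <= _).
rewrite /inner big_seq [RHS]big_seq; apply: eq_bigr => s /Df Ds.
by rewrite big_seq [RHS]big_seq; apply: eq_bigr => t /Df Dt; rewrite GH.
Qed.

Lemma psd_on_diag_ge0 D G x : psd_on D G -> D x -> 0 <= G x x.
Proof.
move=> psdG Dx; have Dx1 : supported_on D [:: (1 : R, x)] := supported_on_seq1 Dx.
by have := psdG _ Dx1; rewrite inner_seq1 !mul1r.
Qed.

End PsdClosure.

Lemma psd_on_average_transpose (R : numFieldType) (T : eqType) (D : T -> Prop)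
    (G : T -> T -> R) :
  psd_on D G -> psd_on D (fun s t => (G s t + G t s) / 2).
Proof.
move=> psdG f Df.
have -> : inner (fun s t => (G s t + G t s) / 2) f f =
    inner (fun s t => 2^-1 * (G s t + G t s)) f f.
  by apply: eq_inner => s t; rewrite mulrC.
have transpose : inner (fun s t => G t s) f f = inner G f f by rewrite innerC.
by rewrite innerZr innerDr transpose mulr_ge0 ?invr_ge0 // addr_ge0 // psdG.
Qed.

Lemma psd_on_comp (R : numDomainType) (S T : eqType) (h : S -> T)
    (D : S -> Prop) (E : T -> Prop) (G : T -> T -> R) :
  (forall s, D s -> E (h s)) -> psd_on E G -> psd_on D (fun s t => G (h s) (h t)).
Proof.
move=> DE psdG f Df; rewrite inner_map; apply: psdG.
by move=> _ /mapP[t /Df Dt ->]; apply: DE.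
Qed.

Lemma psd_on_sum (R : numDomainType) (S T : eqType) (e : S -> seq T)
    (D : S -> Prop) (E : T -> Prop) (G : T -> T -> R) :
  (forall s, D s -> forall t, t \in e s -> E t) -> psd_on E G ->
  psd_on D (fun s s' => \sum_(t <- e s) \sum_(t' <- e s') G t t').
Proof.
move=> DE psdG f Df; pose f' := [seq (s.1, t) | s <- f, t <- e s.2].
have -> : inner (fun s s' => \sum_(t <- e s) \sum_(t' <- e s') G t t') f f =
    inner G f' f'.
  rewrite /inner big_allpairs_dep; apply: eq_bigr => s _ /=.
  under [RHS]eq_bigr do rewrite big_allpairs_dep.
  rewrite [RHS]exchange_big; apply: eq_bigr => s' _ /=.
  by rewrite mulr_sumr; apply: eq_bigr => t _; rewrite mulr_sumr.
apply: psdG => _ /allpairsPdep[s [t [/Df Ds ts ->]]] /=; exact: DE ts.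
Qed.

Section Psd.
Variables (R : rcfType) (T : eqType).
Implicit Types (f g : seq (R * T)) (G H : T -> T -> R) (D : T -> Prop).

Lemma psd_on_cauchy_schwarz D G f g : symmetric_kernel G -> psd_on D G ->
  supported_on D f -> supported_on D g ->
  inner G f g ^+ 2 <= inner G f f * inner G g g.
Proof.
move=> symG psdG Df Dg; pose p := Poly [:: inner G f f; 2 * inner G f g; inner G g g].
have p_ge0 c : 0 <= p.[c].
  have := psdG _ (supported_on_cat Df (supported_on_scale (c := c) Dg)).
  rewrite inner_catl !inner_catr !inner_scalel !inner_scaler [inner G g f]inner_sym //.
  by congr (_ <= _); rewrite horner_Poly /=; ring.
have size_p : (size p <= 3)%N by exact: size_Poly.
by have := deg_le2_poly_ge0 size_p p_ge0; rewrite !coef_Poly /=; lra.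
Qed.

Lemma psd_on_null D G f g : symmetric_kernel G -> psd_on D G ->
  supported_on D f -> supported_on D g -> inner G f f = 0 -> inner G f g = 0.
Proof.
move=> symG psdG Df Dg ff0; have := psd_on_cauchy_schwarz symG psdG Df Dg.
by rewrite ff0 mul0r => fg_le0; apply/eqP; rewrite -sqrf_eq0 eq_le fg_le0 sqr_ge0.
Qed.

(* If <p, p> = <p, e>, then p is the image of e under an orthogonal projection, so
   <p, e> <= <e, e> = 1; an overlap <p, q> = 1 of two such images forces p = e = q. *)
Lemma psd_on_unit_overlap D G e p q g : symmetric_kernel G -> psd_on D G ->
  supported_on D e -> supported_on D p -> supported_on D q -> supported_on D g ->
  inner G e e = 1 -> inner G p p = inner G p e -> inner G q q = inner G q e ->
  inner G p q = 1 -> inner G p g = inner G e g.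
Proof.
move=> symG psdG De Dp Dq Dg ee pp qq pq.
have D_sub f h :
    supported_on D f -> supported_on D h -> supported_on D (f ++ scale (-1) h).
  by move=> Df Dh; apply: supported_on_cat Df (supported_on_scale Dh).
have inner_sub f h : inner G (f ++ scale (-1) h) (f ++ scale (-1) h) =
    inner G f f - 2 * inner G f h + inner G h h.
  rewrite inner_catl !inner_catr !inner_scalel !inner_scaler [inner G h f]inner_sym //.
  ring.
have := psdG _ (D_sub _ _ Dp De); have := psdG _ (D_sub _ _ Dq De).
have := psdG _ (D_sub _ _ Dp Dq); rewrite !inner_sub pp qq pq ee => pq_ge0 qe_ge0 pe_ge0.
have pe0 : inner G (p ++ scale (-1) e) (p ++ scale (-1) e) = 0.
  rewrite inner_sub pp ee; lra.
have := psd_on_null symG psdG (D_sub _ _ Dp De) Dg pe0.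
rewrite inner_catl inner_scalel; lra.
Qed.

(* If G x x = 0, then the quotient is the junk value 0, which is harmless because
   positivity forces G x t = 0 for all t. *)
Definition schur_complement G x s t : R := G s t - G s x * G t x / G x x.

Lemma schur_complement_sym G x :
  symmetric_kernel G -> symmetric_kernel (schur_complement G x).
Proof. by move=> symG s t; rewrite /schur_complement symG [G s x * _]mulrC. Qed.

Lemma schur_complement_psd D G x : symmetric_kernel G -> psd_on D G -> D x ->
  psd_on D (schur_complement G x).
Proof.
move=> symG psdG Dx f Df; set d := G x x.
have Dx1 : supported_on D [:: (1 : R, x)] := supported_on_seq1 Dx.
have inner_x g : inner G g [:: (1, x)] = \sum_(t <- g) t.1 * G t.2 x.
  by apply: eq_bigr => t _; rewrite big_seq1 mulr1.
have inner_xx : inner G [:: (1, x)] [:: (1, x)] = d by rewrite inner_seq1 !mul1r.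
have -> : inner (schur_complement G x) f f = inner G f f - inner G f [:: (1, x)] ^+ 2 / d.
  rewrite inner_x -(inner_rank1 (G^~ x)) -mulrN mulrC -innerZr -innerDr.
  by apply: eq_inner => s t; rewrite /schur_complement mulNr [_^-1 * _]mulrC.
rewrite subr_ge0; have [->|d_neq0] := eqVneq d 0; first by rewrite invr0 mulr0 psdG.
have := psd_on_cauchy_schwarz symG psdG Df Dx1; rewrite inner_xx.
by rewrite ler_pdivrMr // lt_neqAle eq_sym d_neq0 (psd_on_diag_ge0 psdG).
Qed.

Lemma schur_complement_null D G x t : symmetric_kernel G -> psd_on D G -> D x -> D t ->
  schur_complement G x x t = 0.
Proof.
move=> symG psdG Dx Dt; rewrite /schur_complement symG.
have [d0|d_neq0] := eqVneq (G x x) 0; last by rewrite mulrAC divff // mul1r subrr.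
rewrite d0 invr0 mulr0 subr0.
have xx0 : inner G [:: (1, x)] [:: (1, x)] = 0 by rewrite inner_seq1 d0 mulr0.
have D1 u (Du : D u) : supported_on D [:: (1 : R, u)] := supported_on_seq1 Du.
by have := psd_on_null symG psdG (D1 x Dx) (D1 t Dt) xx0; rewrite inner_seq1 !mul1r symG.
Qed.

Lemma psd_on_gram G (r : seq T) : symmetric_kernel G -> psd_on (fun t => t \in r) G ->
  exists W : seq (T -> R), {in r &, forall s t, G s t = \sum_(w <- W) w s * w t}.
Proof.
elim: r G => [|x r IHr] G symG psdG; first by exists [::].
have x_in : x \in x :: r by rewrite mem_head.
have symS := schur_complement_sym x symG.
have [|W WE] := IHr _ symS.
  by apply: sub_psd_on (schur_complement_psd symG psdG x_in) => t tr; rewrite inE tr orbT.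
pose kill_x (w : T -> R) t := if t == x then 0 else w t.
exists ((fun t => G t x / Num.sqrt (G x x)) :: map kill_x W) => s t s_in t_in.
have schurE : schur_complement G x s t = \sum_(w <- W) kill_x w s * kill_x w t.
  rewrite /kill_x; have [->|sx] := eqVneq s x.
    by rewrite (schur_complement_null symG psdG) // big1 // => w _; rewrite mul0r.
  have [->|tx] := eqVneq t x.
    by rewrite symS (schur_complement_null symG psdG) // big1 // => w _; rewrite mulr0.
  by apply: WE; [move: s_in|move: t_in]; rewrite inE ?(negbTE sx) ?(negbTE tx).
rewrite big_cons big_map -schurE /schur_complement mulrACA -invfM -expr2.
by rewrite sqr_sqrtr ?(psd_on_diag_ge0 psdG) // addrC subrK.
Qed.

Lemma psd_on_mul D G H : symmetric_kernel G -> psd_on D G -> psd_on D H ->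
  psd_on D (fun s t => G s t * H s t).
Proof.
move=> symG psdG psdH f Df.
have [|W WE] := @psd_on_gram G (unzip2 f) symG.
  by apply: sub_psd_on psdG => _ /mapP[t /Df Dt ->].
pose weighted (w : T -> R) := [seq (t.1 * w t.2, t.2) | t <- f].
suff -> : inner (fun s t => G s t * H s t) f f =
    \sum_(w <- W) inner H (weighted w) (weighted w).
  apply: sumr_ge0 => w _; apply: psdH => _ /mapP[t /Df Dt ->] //.
under [RHS]eq_bigr do rewrite /inner big_map.
rewrite exchange_big [LHS]big_seq [RHS]big_seq; apply: eq_bigr => s sf.
under [RHS]eq_bigr do rewrite big_map.
rewrite exchange_big [LHS]big_seq [RHS]big_seq; apply: eq_bigr => t tf /=.
rewrite WE ?map_f // mulr_suml mulr_sumr; apply: eq_bigr => w _; ring.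
Qed.

Lemma psd_on_prod D (J : finType) (G : J -> T -> T -> R) :
  (forall j, symmetric_kernel (G j)) -> (forall j, psd_on D (G j)) ->
  psd_on D (fun s t => \prod_j G j s t).
Proof.
move=> symG psdG; elim: (index_enum J) => [|j r IHr].
  apply: (@eq_psd_on _ _ _ (fun _ _ => 1 * 1)) => [s t _ _|f _].
    by rewrite big_nil mulr1.
  by rewrite (inner_rank1 (fun=> 1)) sqr_ge0.
apply: eq_psd_on (psd_on_mul (symG j) (psdG j) IHr) => s t _ _.
by rewrite big_cons.
Qed.

End Psd.

(** * Moments of two commuting families of projectors *)

Section Projective.
Variables (V : nmodType) (I O : eqType).
Implicit Type m : seq (I * O) -> V.

Record projective m : Prop := Projective {
  projective_idem : forall u l v, m (u ++ [:: l; l] ++ v) = m (u ++ [:: l] ++ v);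
  projective_orth : forall u x a a' v, a != a' ->
    m (u ++ [:: (x, a); (x, a')] ++ v) = 0 }.

Lemma projective_rev m : projective m -> projective (m \o rev).
Proof.
move=> [idem orth]; split=> [u l v|u x a a' v ne]; rewrite /comp !rev_cat -!catA.
  exact: idem.
by apply: orth; rewrite eq_sym.
Qed.

Lemma projective_sum (T : Type) (r : seq T) (F : T -> seq (I * O) -> V) :
  (forall t, projective (F t)) -> projective (fun u => \sum_(t <- r) F t u).
Proof.
move=> projF; split=> [u l v|u x a a' v ne].
  by apply: eq_bigr => t _; rewrite (projective_idem (projF t)).
by rewrite big1 // => t _; rewrite (projective_orth (projF t)).
Qed.

End Projective.

Lemma projective_average (R : numFieldType) (I O : eqType) (m m' : seq (I * O) -> R) :
  projective m -> projective m' -> projective (fun u => (m u + m' u) / 2).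
Proof.
move=> [idem orth] [idem' orth']; split=> [u l v|u x a a' v ne].
  by rewrite idem idem'.
by rewrite orth // orth' // addr0 mul0r.
Qed.

Lemma projective_sum_pairs (V : nmodType) (I : eqType) (O : finType)
    (m : seq (I * O) -> V) :
  projective m -> forall i o, \sum_o' m [:: (i, o); (i, o')] = m [:: (i, o)].
Proof.
move=> [idem orth] i o; rewrite (bigD1 o) //= big1 ?addr0 => [|o' ne].
  exact: (idem [::] _ [::]).
by apply: (orth [::] i o o' [::]); rewrite eq_sym.
Qed.

Definition complete (V : nmodType) (I : Type) (O : finType)
    (m : seq (I * O) -> V) : Prop :=
  forall i, \sum_o m [:: (i, o)] = m [::].

Lemma eq_complete (V : nmodType) (I : Type) (O : finType) (m m' : seq (I * O) -> V) :
  m =1 m' -> complete m -> complete m'.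
Proof. by move=> mm' mC i; rewrite -mm' -(mC i); apply: eq_bigr => o _; rewrite mm'. Qed.

Lemma complete_sum (V : nmodType) (I : Type) (O : finType) (T : eqType) (r : seq T)
    (F : T -> seq (I * O) -> V) :
  {in r, forall t, complete (F t)} -> complete (fun u => \sum_(t <- r) F t u).
Proof.
move=> FC i; rewrite exchange_big big_seq [RHS]big_seq.
by apply: eq_bigr => t tr; apply: FC.
Qed.

Definition sizes_in (Ob : nat -> nat -> Prop) {S T : Type} (p : seq S * seq T) : Prop :=
  exists m n, [/\ Ob m n, (size p.1 <= m)%N & (size p.2 <= n)%N].

Lemma sizes_in_rev (Ob : nat -> nat -> Prop) (S T : Type) (p : seq S * seq T) :
  sizes_in Ob p -> sizes_in Ob (rev p.1, rev p.2).
Proof. by move=> [m [n ?]]; exists m, n; rewrite /= !size_rev. Qed.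

Definition moment_kernel (V S T : Type) (M : seq S -> seq T -> V)
    (p q : seq S * seq T) : V :=
  M (p.1 ++ rev q.1) (p.2 ++ rev q.2).

Record moment_functional (R : numDomainType) (Ob : nat -> nat -> Prop)
    (X A Y B : eqType) (M : seq (X * A) -> seq (Y * B) -> R) : Prop :=
  MomentFunctional {
    moment_projectiveA : forall v, projective (M^~ v);
    moment_projectiveB : forall u, projective (M u);
    moment_rev : forall u v, M (rev u) (rev v) = M u v;
    moment_nil : M [::] [::] = 1;
    moment_psd : psd_on (sizes_in Ob) (moment_kernel M) }.

Definition represents (V X A Y B : Type) (M : seq (X * A) -> seq (Y * B) -> V)
    (P : X -> Y -> A -> B -> V) : Prop :=
  forall x y a b, P x y a b = M [:: (x, a)] [:: (y, b)].

Record moment_complete (V : nmodType) (Ob : nat -> nat -> Prop) (X Y : Type)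
    (A B : finType) (M : seq (X * A) -> seq (Y * B) -> V) : Prop := MomentComplete {
  moment_completeA : forall v, sizes_in Ob ([::] : seq (X * A), v) -> complete (M^~ v);
  moment_completeB : forall u, sizes_in Ob (u, [::] : seq (Y * B)) -> complete (M u) }.

Lemma moment_kernel_sym (V S T : Type) (M : seq S -> seq T -> V) :
  (forall u v, M (rev u) (rev v) = M u v) -> symmetric_kernel (moment_kernel M).
Proof. by move=> M_rev p q; rewrite /moment_kernel -M_rev !rev_cat !revK. Qed.

Section Completeness.
Variables (R : rcfType) (Ob : nat -> nat -> Prop).
Hypotheses (Ob10 : Ob 1%N 0%N) (Ob01 : Ob 0%N 1%N).
Variables (X Y : eqType) (A B : finType) (M : seq (X * A) -> seq (Y * B) -> R).
Hypothesis momM : moment_functional Ob M.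

Let G := moment_kernel M.
Let symG : symmetric_kernel G := moment_kernel_sym (moment_rev momM).
Let one : seq (R * (seq (X * A) * seq (Y * B))) := [:: (1, ([::], [::]))].
Let sumA x : seq (R * (seq (X * A) * seq (Y * B))) :=
  [seq (1, ([:: (x, a)], [::])) | a <- index_enum A].
Let sumB y : seq (R * (seq (X * A) * seq (Y * B))) :=
  [seq (1, ([::], [:: (y, b)])) | b <- index_enum B].
Let supported (f : seq (R * (seq (X * A) * seq (Y * B)))) := supported_on (sizes_in Ob) f.

Let supported_one : supported one.
Proof. by apply: supported_on_seq1; exists 1%N, 0%N. Qed.

Let supported_sumA x : supported (sumA x).
Proof. by move=> _ /mapP[a _ ->]; exists 1%N, 0%N. Qed.

Let supported_sumB y : supported (sumB y).
Proof. by move=> _ /mapP[b _ ->]; exists 0%N, 1%N. Qed.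

Let inner_one p : inner G one [:: (1, p)] = M (rev p.1) (rev p.2).
Proof. by rewrite inner_seq1 !mul1r. Qed.

Let inner_sumA x p :
  inner G (sumA x) [:: (1, p)] = \sum_a M ((x, a) :: rev p.1) (rev p.2).
Proof. by rewrite /inner big_map; apply: eq_bigr => a _; rewrite big_seq1 !mul1r. Qed.

Let inner_sumB y p :
  inner G (sumB y) [:: (1, p)] = \sum_b M (rev p.1) ((y, b) :: rev p.2).
Proof. by rewrite /inner big_map; apply: eq_bigr => b _; rewrite big_seq1 !mul1r. Qed.

Let inner_sumA_sumB x y :
  inner G (sumA x) (sumB y) = \sum_a \sum_b M [:: (x, a)] [:: (y, b)].
Proof.
rewrite /inner big_map; apply: eq_bigr => a _.
by rewrite big_map; apply: eq_bigr => b _; rewrite !mul1r.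
Qed.

Let inner_sumAA x : inner G (sumA x) (sumA x) = inner G (sumA x) one.
Proof.
rewrite inner_sumA /inner big_map; apply: eq_bigr => a _; rewrite big_map.
under eq_bigr do rewrite !mul1r.
exact: projective_sum_pairs (moment_projectiveA momM [::]) x a.
Qed.

Let inner_sumBB y : inner G (sumB y) (sumB y) = inner G (sumB y) one.
Proof.
rewrite inner_sumB /inner big_map; apply: eq_bigr => b _; rewrite big_map.
under eq_bigr do rewrite !mul1r.
exact: projective_sum_pairs (moment_projectiveB momM [::]) y b.
Qed.

(* The relations do not include sum_a E^x_a = 1, but a normalised box has
   L (sum_a E^x_a * sum_b F^y_b) = 1, which makes 1 - sum_a E^x_a and
   1 - sum_b F^y_b null vectors of the positive form. *)
Lemma moment_functional_complete (x0 : X) (y0 : Y) :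
  (forall x y, \sum_a \sum_b M [:: (x, a)] [:: (y, b)] = 1) -> moment_complete Ob M.
Proof.
move=> norm1.
have one_unit : inner G one one = 1 by rewrite inner_one (moment_nil momM).
have overlap x y : inner G (sumA x) (sumB y) = 1 by rewrite inner_sumA_sumB.
have overlapC x y : inner G (sumB y) (sumA x) = 1 by rewrite inner_sym.
have supported_rev p : sizes_in Ob p -> supported [:: (1, (rev p.1, rev p.2))].
  by move=> /sizes_in_rev; apply: supported_on_seq1.
split=> [v /supported_rev v_in x|u /supported_rev u_in y].
  have := psd_on_unit_overlap symG (moment_psd momM) supported_one (@supported_sumA x)
    (@supported_sumB y0) v_in one_unit (inner_sumAA x) (inner_sumBB y0) (overlap x y0).
  by rewrite inner_sumA inner_one /= !revK.
have := psd_on_unit_overlap symG (moment_psd momM) supported_one (@supported_sumB y)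
  (@supported_sumA x0) u_in one_unit (inner_sumBB y) (inner_sumAA x0) (overlapC x0 y).
by rewrite inner_sumB inner_one /= !revK.
Qed.

End Completeness.

Lemma is_box_moment (R : realType) (Ob : nat -> nat -> Prop) (X A Y B : finType)
    (M : seq (X * A) -> seq (Y * B) -> R) (P : X -> Y -> A -> B -> R) :
  Ob 1%N 0%N -> Ob 0%N 1%N -> (0 < #|X|)%N -> (0 < #|Y|)%N ->
  (forall x y a b, 0 <= P x y a b) -> represents M P -> M [::] [::] = 1 ->
  moment_complete Ob M -> is_box P.
Proof.
move=> Ob10 Ob01 X0 Y0 P_ge0 MP M1 [complA complB].
have sumB x y a : \sum_b P x y a b = M [:: (x, a)] [::].
  by under eq_bigr do rewrite MP; apply: complB; exists 1%N, 0%N.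
have sumA x y b : \sum_a P x y a b = M [::] [:: (y, b)].
  by under eq_bigr do rewrite MP; apply: complA; exists 0%N, 1%N.
split; first by split.
split=> [x y|x y y' a|x x' y b]; rewrite ?sumB ?sumA //.
under eq_bigr do rewrite sumB.
by rewrite complA //; exists 0%N, 1%N.
Qed.

(** * Functionals on words *)

Lemma extend_to_classes (T V : Type) (v0 : V) (E : T -> T -> Prop) (D Z : T -> Prop)
    (L : T -> V) :
  (forall t, E t t) -> (forall s t, E s t -> E t s) ->
  (forall s t u, E s t -> E t u -> E s u) -> (forall s t, E s t -> Z s -> Z t) ->
  (forall s t, D s -> D t -> E s t -> L s = L t) ->
  (forall t, D t -> Z t -> L t = v0) ->
  exists L' : T -> V, [/\ forall s t, E s t -> L' s = L' t,
    forall t, Z t -> L' t = v0 & forall t, D t -> L' t = L t].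
Proof.
move=> Erefl Esym Etrans EZ L_E L_Z.
pose L' t :=
  if pselect (exists s, D s /\ E s t) is left ex then L (sval (cid ex)) else v0.
have L'E s t : D s -> E s t -> L' t = L s.
  move=> Ds Est; rewrite /L'; case: pselect => [ex|[]]; last by exists s.
  case: (cid ex) => s' [Ds' Es't] /=; apply: L_E => //.
  exact: Etrans Es't (Esym _ _ Est).
have L'out t : (forall s, D s -> ~ E s t) -> L' t = v0.
  by move=> notE; rewrite /L'; case: pselect => // ex; have [s [/notE]] := ex.
exists L'; split=> [s t Est|t Zt|t Dt]; last exact: L'E.
  have [[r [Dr Ers]]|noE] := pselect (exists r, D r /\ E r s).
    by rewrite (L'E r s) // (L'E r t) //; apply: Etrans Est.
  rewrite !L'out // => r Dr Er; apply: noE; exists r => //.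
  by split=> //; apply: Etrans (Esym _ _ Est).
have [[s [Ds Est]]|noE] := pselect (exists s, D s /\ E s t).
  by rewrite (L'E s t) // L_Z //; apply: EZ Zt; apply: Esym.
by apply: L'out => s Ds Es; apply: noE; exists s.
Qed.

Lemma pmap_rev (S T : Type) (f : S -> option T) s : pmap f (rev s) = rev (pmap f s).
Proof.
elim: s => //= x s IHs; rewrite rev_cons -cats1 pmap_cat IHs /=.
by case: (f x) => [y|] /=; rewrite ?cats0 ?rev_cons -?cats1.
Qed.

Section Words.
Variables (R : realType) (X A Y B : finType).
Local Notation word := (word X A Y B).
Local Notation fsum := (fsum R X A Y B).
Implicit Types (w p q : word) (f g : fsum) (L : word -> R).

Lemma coef_nil w : coef ([::] : fsum) w = 0.
Proof. by rewrite /coef big_nil. Qed.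

Lemma coef_cons c w' f w : coef ((c, w') :: f) w = c * (w' == w)%:R + coef f w.
Proof. by rewrite /coef big_cons /=; case: eqP; rewrite ?mulr1 // mulr0 add0r. Qed.

Lemma coef_cat f g w : coef (f ++ g) w = coef f w + coef g w.
Proof. by rewrite /coef big_cat. Qed.

Lemma coef_scale c f w : coef (scale c f) w = c * coef f w.
Proof. by rewrite /coef big_map mulr_sumr. Qed.

Lemma evalL_coef L f r : uniq r -> {subset unzip2 f <= r} ->
  evalL L f = \sum_(w <- r) coef f w * L w.
Proof.
move=> uniq_r sub; under [RHS]eq_bigr do rewrite mulr_suml.
rewrite (exchange_big_dep predT) //= /evalL big_seq [RHS]big_seq; apply: eq_bigr => t tf.
rewrite -big_filter (_ : [seq w <- r | t.2 == w] = [:: t.2]) ?big_seq1 //.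
rewrite -(filter_pred1_uniq uniq_r (sub _ (map_f _ tf))).
by apply: eq_filter => w; rewrite /= eq_sym.
Qed.

Lemma eq_evalL L f g : coef f =1 coef g -> evalL L f = evalL L g.
Proof.
move=> fg; pose r := undup (unzip2 f ++ unzip2 g).
have f_sub : {subset unzip2 f <= r} by move=> w wf; rewrite mem_undup mem_cat wf.
have g_sub : {subset unzip2 g <= r} by move=> w wg; rewrite mem_undup mem_cat wg orbT.
rewrite (evalL_coef L (undup_uniq _) f_sub) (evalL_coef L (undup_uniq _) g_sub).
by apply: eq_bigr => w _; rewrite fg.
Qed.

Lemma eq_in_ideal f g : coef f =1 coef g -> in_ideal f -> in_ideal g.
Proof. by move=> fg [ts [rel ts_f]]; exists ts; split=> // w; rewrite -fg. Qed.

Lemma in_ideal_nil : in_ideal ([::] : fsum).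
Proof. by exists [::]. Qed.

Lemma in_ideal_cat f g : in_ideal f -> in_ideal g -> in_ideal (f ++ g).
Proof.
move=> [ts [rel_ts fE]] [ts' [rel_ts' gE]]; exists (ts ++ ts'); split.
  by move=> t; rewrite mem_cat => /orP[/rel_ts|/rel_ts'].
by move=> w; rewrite coef_cat fE gE /ideal_sum map_cat flatten_cat coef_cat.
Qed.

Lemma in_ideal_scale c f : in_ideal f -> in_ideal (scale c f).
Proof.
move=> [ts [rel fE]]; exists [seq (c * t.1.1.1, t.1.1.2, t.1.2, t.2) | t <- ts].
split=> [_ /mapP[t /rel ? ->] //|w].
rewrite coef_scale fE -coef_scale /ideal_sum; congr (coef _ w).
rewrite /scale map_flatten -!map_comp; congr flatten; apply: eq_map => t /=.
by rewrite -map_comp; apply: eq_map => d /=; rewrite mulrA.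
Qed.

Lemma in_ideal_relator p (r : fsum) q :
  is_relator r -> in_ideal [seq (d.1, p ++ d.2 ++ q) | d <- r].
Proof.
move=> rel; exists [:: (1, p, r, q)]; split=> [t|w]; first by rewrite inE => /eqP->.
by rewrite /ideal_sum /= cats0; congr (coef _ w); apply: eq_map => d; rewrite mul1r.
Qed.

Definition weq w w' : Prop := in_ideal ([:: (1, w); (-1, w')] : fsum).

Lemma weq_refl w : weq w w.
Proof. by apply: eq_in_ideal in_ideal_nil => w'; rewrite !coef_cons coef_nil; ring. Qed.

Lemma weq_sym w w' : weq w w' -> weq w' w.
Proof.
move=> /(in_ideal_scale (-1)); apply: eq_in_ideal => v.
by rewrite coef_scale !coef_cons coef_nil; ring.
Qed.

Lemma weq_trans w1 w2 w3 : weq w1 w2 -> weq w2 w3 -> weq w1 w3.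
Proof.
move=> w12 w23; apply: eq_in_ideal (in_ideal_cat w12 w23) => w.
by rewrite coef_cat !coef_cons coef_nil; ring.
Qed.

Lemma in_ideal_weq w w' :
  weq w w' -> in_ideal ([:: (1, w)] : fsum) -> in_ideal ([:: (1, w')] : fsum).
Proof.
move=> /weq_sym w'w w0; apply: eq_in_ideal (in_ideal_cat w'w w0) => v.
by rewrite coef_cat !coef_cons coef_nil; ring.
Qed.

Record word_functional L : Prop := WordFunctional {
  word_functional_comm : forall p e h q,
    L (p ++ [:: inl e; inr h] ++ q) = L (p ++ [:: inr h; inl e] ++ q);
  word_functional_idem : forall p l q, L (p ++ [:: l; l] ++ q) = L (p ++ [:: l] ++ q);
  word_functional_orthA : forall p x a a' q, a != a' ->
    L (p ++ [:: inl (x, a); inl (x, a')] ++ q) = 0;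
  word_functional_orthB : forall p y b b' q, b != b' ->
    L (p ++ [:: inr (y, b); inr (y, b')] ++ q) = 0 }.

Lemma evalL_ideal L f : word_functional L -> in_ideal f -> evalL L f = 0.
Proof.
move=> [comm idem orthA orthB] [ts [rel /(eq_evalL L) ->]].
rewrite /evalL /ideal_sum big_flatten big_map big_seq big1 // => -[[[c p] r] q] /rel /=.
rewrite big_map; case=> [[e [h ->]]|]; first by rewrite !big_cons big_nil /= comm; ring.
case=> [[l ->]|]; first by rewrite !big_cons big_nil /= idem; ring.
case=> [[x [a [a' [ne ->]]]]|[y [b [b' [ne ->]]]]]; rewrite big_seq1 /=.
  by rewrite orthA ?mulr0.
by rewrite orthB ?mulr0.
Qed.

Lemma weq_word_functional L : (forall w w', weq w w' -> L w = L w') ->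
  (forall w, in_ideal ([:: (1, w)] : fsum) -> L w = 0) -> word_functional L.
Proof.
move=> L_weq L_ideal; split=> [p e h q|p l q|p x a a' q ne|p y b b' q ne].
- apply: L_weq; apply: (in_ideal_relator p (r := [:: (1, _); (-1, _)]) q).
  by left; exists e, h.
- apply: L_weq; apply: (in_ideal_relator p (r := [:: (1, _); (-1, _)]) q).
  by right; left; exists l.
- apply: L_ideal; apply: (in_ideal_relator p (r := [:: (1, _)]) q).
  by right; right; left; exists x, a, a'.
- apply: L_ideal; apply: (in_ideal_relator p (r := [:: (1, _)]) q).
  by right; right; right; exists y, b, b'.
Qed.

(* Every relator is a difference of two words or a single word, so a functional that
   is only given on D extends by 0 on the classes of words that do not meet D. *)
Lemma extend_word_functional (D : word -> Prop) L :
  (forall f, in_ideal f -> (forall w, coef f w != 0 -> D w) -> evalL L f = 0) ->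
  exists2 L', word_functional L' & forall w, D w -> L' w = L w.
Proof.
move=> ker.
have L_weq w w' : D w -> D w' -> weq w w' -> L w = L w'.
  move=> Dw Dw' /ker; rewrite /evalL !big_cons big_nil /= => kerE.
  suff : 1 * L w + (-1 * L w' + 0) = 0 by lra.
  apply: kerE => v; rewrite !coef_cons coef_nil.
  case: (w =P v) => [<- //|_]; case: (w' =P v) => [<- //|_].
  by rewrite !mulr0 !addr0 eqxx.
have L_ideal w : D w -> in_ideal ([:: (1, w)] : fsum) -> L w = 0.
  move=> Dw /ker; rewrite /evalL big_seq1 mul1r; apply=> v.
  by rewrite coef_cons coef_nil; case: (w =P v) => [<- //|_]; rewrite mulr0 addr0 eqxx.
have [L' [L'_weq L'_ideal L'D]] :=
  extend_to_classes weq_refl weq_sym weq_trans in_ideal_weq L_weq L_ideal.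
by exists L' => //; apply: weq_word_functional.
Qed.

Definition lettersA w : seq (X * A) :=
  pmap (fun l => if l is inl e then Some e else None) w.
Definition lettersB w : seq (Y * B) :=
  pmap (fun l => if l is inr h then Some h else None) w.

Definition sorted_word (u : seq (X * A)) (v : seq (Y * B)) : word :=
  map inl u ++ map inr v.

Lemma lettersA_cat w w' : lettersA (w ++ w') = lettersA w ++ lettersA w'.
Proof. exact: pmap_cat. Qed.

Lemma lettersB_cat w w' : lettersB (w ++ w') = lettersB w ++ lettersB w'.
Proof. exact: pmap_cat. Qed.

Lemma lettersA_rev w : lettersA (rev w) = rev (lettersA w).
Proof. exact: pmap_rev. Qed.

Lemma lettersB_rev w : lettersB (rev w) = rev (lettersB w).
Proof. exact: pmap_rev. Qed.

Lemma lettersA_sorted u v : lettersA (sorted_word u v) = u.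
Proof. by elim: u => [|e u /= ->] //; elim: v. Qed.

Lemma lettersB_sorted u v : lettersB (sorted_word u v) = v.
Proof. by elim: u => [|e u //]; elim: v => //= h v ->. Qed.

Lemma word_functional_sort L w : word_functional L ->
  L w = L (sorted_word (lettersA w) (lettersB w)).
Proof.
move=> funL; have move_right p h u q :
    L (p ++ inr h :: map inl u ++ q) = L (p ++ map inl u ++ inr h :: q).
  elim: u p => //= e u IHu p; rewrite -(word_functional_comm funL p e h (_ ++ _)) /=.
  by rewrite -(cat_rcons (inl e)) IHu cat_rcons.
suff prefix p : L (p ++ w) = L (p ++ sorted_word (lettersA w) (lettersB w)).
  exact: (prefix [::]).
elim: w p => // -[e|h] w IHw p; rewrite -cat_rcons IHw cat_rcons //=.
by rewrite move_right.
Qed.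

Lemma word_functional_moments (M : seq (X * A) -> seq (Y * B) -> R) :
  (forall v, projective (M^~ v)) -> (forall u, projective (M u)) ->
  word_functional (fun w => M (lettersA w) (lettersB w)).
Proof.
move=> projA projB.
split=> [p e h q|p [e|h] q|p x a a' q ne|p y b b' q ne];
  rewrite !(lettersA_cat, lettersB_cat) //=.
- exact: projective_idem (projA _) _ _ _.
- exact: projective_idem (projB _) _ _ _.
- exact: projective_orth (projA _) _ _ _ _ _ ne.
- exact: projective_orth (projB _) _ _ _ _ _ ne.
Qed.

Section SortedMoments.
Variable L : word -> R.
Hypothesis funL : word_functional L.

Lemma projectiveA_sorted v : projective (fun u => L (sorted_word u v)).
Proof.
split=> [u l u'|u x a a' u' ne]; rewrite /sorted_word !map_cat -!catA.
  exact: word_functional_idem.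
exact: word_functional_orthA.
Qed.

Lemma projectiveB_sorted u : projective (fun v => L (sorted_word u v)).
Proof.
split=> [v l v'|v y b b' v' ne]; rewrite /sorted_word !map_cat catA.
  by rewrite (word_functional_idem funL (_ ++ _)) -catA.
exact: (word_functional_orthB funL (_ ++ _)).
Qed.

Lemma moment_kernel_sorted w w' :
  moment_kernel (fun u v => L (sorted_word u v))
    (lettersA w, lettersB w) (lettersA w', lettersB w') = L (w ++ conjw w').
Proof.
rewrite /moment_kernel /conjw -lettersA_rev -lettersB_rev -lettersA_cat -lettersB_cat.
by rewrite -word_functional_sort.
Qed.

End SortedMoments.

Section Positivity.
Variable Ob : nat -> nat -> Prop.
Hypotheses (Ob10 : Ob 1%N 0%N) (Ob01 : Ob 0%N 1%N).

Lemma in_OP w : in_O Ob w <->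
  exists2 t, sizes_in Ob t & w = sorted_word t.1 t.2.
Proof.
split=> [[m [n [Omn [u [v [su sv ->]]]]]]|[[u v] [m [n [Omn su sv]]] ->]].
  by exists (u, v) => //; exists m, n.
by exists m, n; split=> //; exists u, v.
Qed.

Lemma psd_on_sorted L : word_functional L ->
  psd_on (in_O Ob) (fun w w' => L (w ++ conjw w')) ->
  psd_on (sizes_in Ob)
    (moment_kernel (fun u v => L (sorted_word u v))).
Proof.
move=> funL psdL; pose word_of (t : seq (X * A) * seq (Y * B)) := sorted_word t.1 t.2.
apply: eq_psd_on (psd_on_comp (h := word_of) _ psdL) => [s t _ _|t t_in].
  rewrite -moment_kernel_sorted // !lettersA_sorted !lettersB_sorted.
  by rewrite -!surjective_pairing.
by apply/in_OP; exists t.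
Qed.

Lemma psd_on_letters (M : seq (X * A) -> seq (Y * B) -> R) :
  psd_on (sizes_in Ob) (moment_kernel M) ->
  psd_on (in_O Ob) (fun w w' => M (lettersA (w ++ conjw w')) (lettersB (w ++ conjw w'))).
Proof.
move=> psdM; pose letters (w : word) := (lettersA w, lettersB w).
apply: eq_psd_on (psd_on_comp (h := letters) _ psdM) => [w w' _ _|w].
  by rewrite lettersA_cat lettersB_cat lettersA_rev lettersB_rev.
by move=> /in_OP[[u v] uv_in ->]; rewrite /letters lettersA_sorted lettersB_sorted.
Qed.

Lemma moment_functional_of_word L : word_functional L -> L [::] = 1 ->
  psd_on (in_O Ob) (fun w w' => L (w ++ conjw w')) ->
  moment_functional Ob
    (fun u v => (L (sorted_word u v) + L (sorted_word (rev u) (rev v))) / 2).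
Proof.
move=> funL L1 psdL; split=> [v|u|u v||].
- apply: projective_average (projectiveA_sorted funL v) _.
  exact: projective_rev (projectiveA_sorted funL (rev v)).
- apply: projective_average (projectiveB_sorted funL u) _.
  exact: projective_rev (projectiveB_sorted funL (rev u)).
- by rewrite !revK addrC.
- by rewrite L1; lra.
apply: eq_psd_on (psd_on_average_transpose (psd_on_sorted funL psdL)) => s t _ _.
by rewrite /moment_kernel !rev_cat !revK.
Qed.

Lemma O_positiveP (P : X -> Y -> A -> B -> R) : O_positive Ob P <->
  is_box P /\ exists2 M, moment_functional Ob M & represents M P.
Proof.
split=> [[boxP [L0 [ker L01 posL0 L0P]]]|[boxP [M momM MP]]]; split=> //.
  have [L funL LL0] := extend_word_functional ker.
  have in_one : in_O Ob ([::] : word).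
    by apply/in_OP; exists ([::], [::]) => //; exists 1%N, 0%N.
  exists (fun u v => (L (sorted_word u v) + L (sorted_word (rev u) (rev v))) / 2).
    apply: moment_functional_of_word => //; first by rewrite LL0 //; exists [::], [::].
    by apply: eq_psd_on posL0 => w w' Ow Ow'; rewrite LL0 //; exists w, w'.
  move=> x y a b; rewrite L0P -LL0; last first.
    exists [:: inl (x, a)], [:: inr (y, b)]; split=> //; apply/in_OP.
      by exists ([:: (x, a)], [::]) => //; exists 1%N, 0%N.
    by exists ([::], [:: (y, b)]) => //; exists 0%N, 1%N.
  by rewrite /sorted_word /=; lra.
have funL := word_functional_moments (moment_projectiveA momM) (moment_projectiveB momM).
exists (fun w => M (lettersA w) (lettersB w)); split=> //.
- by move=> f f_ideal _; apply: evalL_ideal.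
- exact: moment_nil momM.
exact: psd_on_letters (moment_psd momM).
Qed.

End Positivity.
End Words.

(** * Wirings as sums over the leaves of the decision trees *)

Lemma sum_dffun_prod (R : comPzSemiRingType) (J : finType) (T : J -> finType)
    (F : forall j, T j -> R) :
  \sum_(a : {dffun forall j, T j}) \prod_j F j (a j) = \prod_j \sum_(x : T j) F j x.
Proof.
pose F' j : {ffun T j -> R} := [ffun x => F j x].
transitivity (\prod_j \sum_(x : T j) F' j x); last first.
  by apply: eq_bigr => j _; apply: eq_bigr => x _; rewrite ffunE.
under [RHS]eq_bigr do rewrite (big_tag (fun j x => F' j x)).
rewrite bigA_distr_big_dep -big_fprod.
rewrite (reindex (@dffun_of_fprod _ T)); last exact/onW_bij/dffun_of_fprod_bij.
by apply: eq_bigr => a _; apply: eq_bigr => j _; rewrite !ffunE.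
Qed.

Section Wiring.
Variables (R : comPzRingType) (K : nat) (I O : 'I_K -> finType).

Local Notation history := (forall k, seq (I k * O k)).

Definition nil_history : history := fun=> [::].
Definition cat_history (s s' : history) : history := fun k => s k ++ s' k.
Definition rev_history (s : history) : history := fun k => rev (s k).

Lemma cat_historyA s1 s2 s3 :
  cat_history s1 (cat_history s2 s3) = cat_history (cat_history s1 s2) s3.
Proof. by apply: functional_extensionality_dep => k; rewrite /cat_history catA. Qed.

Lemma cat_history0 s : cat_history s nil_history = s.
Proof. by apply: functional_extensionality_dep => k; rewrite /cat_history cats0. Qed.

Fixpoint leaves (Out : Type) (t : strat I O Out) (s : history) : seq (Out * history) :=
  match t with
  | Leaf r => [:: (r, s)]
  | Probe k i c =>
      flatten [seq leaves (c o) (dfwith s [:: (i, o)]) | o <- index_enum (O k)]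
  end.

Section Leaves.
Variable Out : eqType.
Implicit Types (t : strat I O Out) (s : history) (p q : Out * history).

Lemma big_leaves_probe k i (c : O k -> strat I O Out) s (Q : pred (Out * history))
    (F : Out * history -> R) :
  \sum_(p <- leaves (Probe i c) s | Q p) F p =
  \sum_o \sum_(p <- leaves (c o) (dfwith s [:: (i, o)]) | Q p) F p.
Proof. by rewrite /= big_flatten big_map. Qed.

Lemma leaves_probeP k i (c : O k -> strat I O Out) s p :
  p \in leaves (Probe i c) s -> exists o, p \in leaves (c o) (dfwith s [:: (i, o)]).
Proof. by move=> /= /flattenP[_ /mapP[o _ ->] po]; exists o. Qed.

Lemma leaves_used t used s p k : once_from t used -> k \in used ->
  p \in leaves t s -> p.2 k = s k.
Proof.
elim: t used s => [r|k' i c IHc] used s; first by move=> _ _; rewrite inE => /eqP->.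
move=> [k'_unused once_c] k_used /leaves_probeP[o /(IHc o _ _ (once_c o)) ->].
  by rewrite dfwith_out //; apply: contraNneq k'_unused => ->.
by rewrite inE k_used orbT.
Qed.

Lemma size_leaves t s p k :
  (size (s k) <= 1)%N -> p \in leaves t s -> (size (p.2 k) <= 1)%N.
Proof.
elim: t s => [r|k' i c IHc] s size_s; first by rewrite inE => /eqP->.
move=> /leaves_probeP[o]; apply: IHc.
by have [<-|ne] := eqVneq k' k; rewrite ?dfwith_in ?dfwith_out.
Qed.

Definition orthogonal_histories s s' : Prop :=
  exists k i o o', [/\ o != o', s k = [:: (i, o)] & s' k = [:: (i, o')]].

Lemma sum_leaves_orthogonal t used s (G : Out * history -> Out * history -> R) :
  once_from t used -> (forall p q, orthogonal_histories p.2 q.2 -> G p q = 0) ->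
  \sum_(p <- leaves t s) \sum_(q <- leaves t s) G p q = \sum_(p <- leaves t s) G p p.
Proof.
move=> once_t G0; elim: t used s once_t => [r|k i c IHc] used s /=.
  by rewrite !big_seq1.
move=> [_ once_c]; rewrite !big_leaves_probe; apply: eq_bigr => o _.
rewrite -(IHc o _ _ (once_c o)) big_seq [RHS]big_seq; apply: eq_bigr => p p_in.
rewrite big_leaves_probe (bigD1 o) //= [X in _ + X]big1 ?addr0 // => o' ne.
rewrite big_seq big1 // => q q_in; apply: G0; exists k, i, o, o'.
rewrite eq_sym ne (leaves_used (once_c o) _ p_in) ?inE ?eqxx //.
by rewrite (leaves_used (once_c o') _ q_in) ?inE ?eqxx // !dfwith_in.
Qed.

Lemma sum_leaves_complete t used s (m : forall k, seq (I k * O k) -> R) :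
  once_from t used -> (forall k, k \notin used -> s k = [::]) ->
  (forall k, complete (m k)) ->
  \sum_(p <- leaves t s) \prod_k m k (p.2 k) = \prod_k m k (s k).
Proof.
move=> once_t s_unused mC; elim: t used s once_t s_unused => [r|k i c IHc] used s /=.
  by rewrite big_seq1.
move=> [k_unused once_c] s_unused; rewrite big_leaves_probe.
transitivity (\sum_o \prod_j m j (dfwith s [:: (i, o)] j)).
  apply: eq_bigr => o _; apply: IHc (once_c o) _ => j.
  by rewrite inE negb_or => /andP[jk ju]; rewrite dfwith_out 1?eq_sym ?s_unused.
rewrite [RHS](bigD1 k) //= s_unused // -(mC k i) mulr_suml; apply: eq_bigr => o _.
rewrite (bigD1 k) //= dfwith_in; congr (_ * _); apply: eq_bigr => j jk.
by rewrite dfwith_out 1?eq_sym.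
Qed.

Lemma input_used t used (a : forall k, O k) k :
  once_from t used -> k \in used -> input t a k = None.
Proof.
elim: t used => [//|k' i c IHc] used /= [k'_unused once_c] k_used.
case: eqP => [e|_]; first by rewrite e k_used in k'_unused.
by apply: IHc (once_c _) _; rewrite inE k_used orbT.
Qed.

Lemma input_probe k (i : I k) (c : O k -> strat I O Out) (a : forall k, O k) :
  input (Probe i c) a k = Some i.
Proof. by rewrite /=; case: eqP => // e; rewrite eq_axiomK. Qed.

Lemma input_probe_neq k k' (i : I k) (c : O k -> strat I O Out) (a : forall k, O k) :
  k != k' -> input (Probe i c) a k' = input (c (a k)) a k'.
Proof. by rewrite /=; case: eqP. Qed.

End Leaves.

Section Marginals.
Variables (J Q : finType) (w : option J -> Q -> R).

Definition observed_weight (u : seq (J * Q)) (o : Q) : R :=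
  if u is (i, o') :: _ then w (Some i) o *+ (o == o') else w None o.

Definition observed_marginal (u : seq (J * Q)) : R := \sum_o observed_weight u o.

Lemma observed_marginal_nil : observed_marginal [::] = \sum_o w None o.
Proof. by []. Qed.

Lemma observed_marginal_seq1 i o : observed_marginal [:: (i, o)] = w (Some i) o.
Proof.
rewrite /observed_marginal (bigD1 o) //= eqxx big1 ?addr0 // => o' /negbTE->.
exact: mulr0n.
Qed.

End Marginals.

(* A tree entered with history s has already fixed the outputs recorded in s, and the
   outputs of the boxes that it leaves unprobed are summed out. *)
Lemma sum_results (Out : eqType) (t : strat I O Out) used (s : history) (r : Out)
    (w : forall k, option (I k) -> O k -> R) : once_from t used ->
  \sum_(a : {dffun forall k, O k} | result t a == r)
     \prod_k (if input t a k is Some i then w k (Some i) (a k)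
              else observed_weight (w k) (s k) (a k)) =
  \sum_(p <- leaves t s | p.1 == r) \prod_k observed_marginal (w k) (p.2 k).
Proof.
elim: t used s => [r'|k i c IHc] used s.
  move=> _; rewrite big_cons big_nil /=; case: eqP => _; last by rewrite big_pred0.
  by rewrite (sum_dffun_prod (fun k => observed_weight (w k) (s k))) addr0.
move=> [_ once_c]; rewrite big_leaves_probe.
under [RHS]eq_bigr => o _ do rewrite -(IHc o _ _ (once_c o)).
rewrite (exchange_big_dep predT) // big_mkcond; apply: eq_bigr => a _.
have k_used o : input (c o) a k = None.
  by apply: input_used (once_c o) _; rewrite inE eqxx.
rewrite [RHS]big_mkcond (bigD1 (a k)) // [X in _ = _ + X]big1 ?addr0; last first.
  move=> o /= ne; case: ifP => // _; rewrite (bigD1 k) //= k_used dfwith_in /=.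
  by rewrite eq_sym (negbTE ne) mulr0n mul0r.
case: ifP => // _; apply: eq_bigr => j _; have [<-|kj] := eqVneq k j.
  by rewrite input_probe k_used dfwith_in /= eqxx.
by rewrite input_probe_neq // dfwith_out.
Qed.

Section Expand.
Variables (X' A' : eqType) (T : X' -> strat I O A').

Definition histories (l : X' * A') : seq history :=
  [seq p.2 | p <- leaves (T l.1) nil_history & p.1 == l.2].

(* The effective projector of the event (x, a) is the sum, over the leaves of T x with
   outcome a, of the products of the projectors met on the way; expand multiplies out a
   word of effective projectors. *)
Fixpoint expand (u : seq (X' * A')) : seq history :=
  if u is l :: u' then [seq cat_history p s | p <- histories l, s <- expand u']
  else [:: nil_history].

Lemma big_histories l (F : history -> R) :
  \sum_(s <- histories l) F s =
  \sum_(p <- leaves (T l.1) nil_history | p.1 == l.2) F p.2.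
Proof. by rewrite /histories big_map big_filter. Qed.

Lemma mem_expand_nil : nil_history \in expand [::].
Proof. exact: mem_head. Qed.

Lemma big_expand_nil (F : history -> R) : \sum_(s <- expand [::]) F s = F nil_history.
Proof. by rewrite big_seq1. Qed.

Lemma big_expand_cons l u (F : history -> R) :
  \sum_(s <- expand (l :: u)) F s =
  \sum_(p <- histories l) \sum_(s <- expand u) F (cat_history p s).
Proof. exact: big_allpairs_dep. Qed.

Lemma big_expand_seq1 l (F : history -> R) :
  \sum_(s <- expand [:: l]) F s = \sum_(s <- histories l) F s.
Proof.
by rewrite big_expand_cons; apply: eq_bigr => p _; rewrite big_expand_nil cat_history0.
Qed.

Lemma big_expand_cat u v (F : history -> R) :
  \sum_(s <- expand (u ++ v)) F s =
  \sum_(s <- expand u) \sum_(s' <- expand v) F (cat_history s s').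
Proof.
elim: u F => [|l u IHu] F; first by rewrite big_expand_nil.
rewrite cat_cons !big_expand_cons; apply: eq_bigr => p _; rewrite IHu.
by apply: eq_bigr => s _; apply: eq_bigr => s' _; rewrite cat_historyA.
Qed.

Lemma size_histories l s k : s \in histories l -> (size (s k) <= 1)%N.
Proof.
by move=> /mapP[p]; rewrite mem_filter => /andP[_ /(size_leaves (k := k))] + ->; apply.
Qed.

Lemma size_expand u s k : s \in expand u -> (size (s k) <= size u)%N.
Proof.
elim: u s => [|l u IHu] s /=; first by rewrite inE => /eqP->.
move=> /allpairsP[[p s'] /= [/(size_histories k) size_p /IHu size_s' ->]].
by rewrite size_cat -add1n leq_add.
Qed.

Lemma big_expand_rev u (F : history -> R) :
  \sum_(s <- expand (rev u)) F s = \sum_(s <- expand u) F (rev_history s).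
Proof.
elim: u F => [|l u IHu] F; first by rewrite /= !big_seq1.
rewrite rev_cons -cats1 big_expand_cat IHu big_expand_cons.
under eq_bigr do rewrite big_expand_seq1.
rewrite exchange_big /= big_seq [RHS]big_seq; apply: eq_bigr => p p_in.
apply: eq_bigr => s _; congr F; apply: functional_extensionality_dep => k.
rewrite /cat_history /rev_history rev_cat; congr (_ ++ _).
by have := size_histories k p_in; case: (p k) => [|x [|]].
Qed.

Hypothesis onceT : forall x, once (T x).

Lemma sum_histories_orthogonal x a a' (G : history -> history -> R) :
  (forall s s', orthogonal_histories s s' -> G s s' = 0) ->
  \sum_(s <- histories (x, a)) \sum_(s' <- histories (x, a')) G s s' =
  \sum_(s <- histories (x, a)) G s s *+ (a == a').
Proof.
move=> G0; pose r := leaves (T x) nil_history.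
pose sel p q := if (p.1 == a) && (q.1 == a') then G p.2 q.2 else 0.
transitivity (\sum_(p <- r) \sum_(q <- r) sel p q).
  rewrite big_histories big_mkcond; apply: eq_bigr => p _ /=; rewrite /sel.
  case: (p.1 == a); last by rewrite big1.
  by rewrite big_histories big_mkcond.
rewrite (sum_leaves_orthogonal _ (onceT x)) => [|p q /G0 pq0]; last first.
  by rewrite /sel pq0 if_same.
rewrite big_histories [RHS]big_mkcond; apply: eq_bigr => p _ /=.
by rewrite /sel; have [->|] //= := eqVneq p.1 a; case: eqP.
Qed.

Lemma projective_expand (m : forall k, seq (I k * O k) -> R) :
  (forall k, projective (m k)) ->
  projective (fun u => \sum_(s <- expand u) \prod_k m k (s k)).
Proof.
move=> mP; pose H s p q s' : R := \prod_k m k (s k ++ p k ++ q k ++ s' k).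
have pairE u x a a' v :
    \sum_(s <- expand (u ++ [:: (x, a); (x, a')] ++ v)) \prod_k m k (s k) =
    \sum_(s <- expand u) \sum_(s' <- expand v)
      \sum_(p <- histories (x, a)) H s p p s' *+ (a == a').
  rewrite big_expand_cat; apply: eq_bigr => s _.
  rewrite big_expand_cat exchange_big; apply: eq_bigr => s' _.
  rewrite big_expand_cons; under eq_bigr do rewrite big_expand_seq1.
  rewrite -(sum_histories_orthogonal _ _ _ (G := fun p q => H s p q s')); last first.
    move=> p q [k [i [o [o' [ne pk qk]]]]]; rewrite /H (bigD1 k) //= pk qk.
    by rewrite (projective_orth (mP k) (s k) i (s' k) ne) mul0r.
  do 2![apply: eq_bigr => ? _]; apply: eq_bigr => k _.
  by rewrite /cat_history -catA.
split=> [u [x a] v|u x a a' v ne]; last first.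
  rewrite pairE (negbTE ne) big1 // => s _; rewrite big1 // => s' _.
  by rewrite big1 // => p _; rewrite mulr0n.
rewrite pairE [RHS]big_expand_cat; apply: eq_bigr => s _.
rewrite [RHS]big_expand_cat [RHS]big_expand_seq1 [RHS]exchange_big.
apply: eq_bigr => s' _; rewrite big_seq [RHS]big_seq; apply: eq_bigr => p p_in.
rewrite eqxx; apply: eq_bigr => k _; rewrite /cat_history.
by have := size_histories k p_in; case: (p k) => [|l [|]] //= _; apply: projective_idem.
Qed.

Lemma sum_outputs x a (w : forall k, option (I k) -> O k -> R) :
  \sum_(o : {dffun forall k, O k} | result (T x) o == a)
    \prod_k w k (input (T x) o k) (o k) =
  \sum_(s <- expand [:: (x, a)]) \prod_k observed_marginal (w k) (s k).
Proof.
rewrite big_expand_seq1 big_histories -(sum_results _ _ _ (onceT x)).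
by apply: eq_bigr => o _; apply: eq_bigr => k _; case: (input _ o k).
Qed.

End Expand.

Lemma complete_expand (X' : eqType) (A' : finType) (T : X' -> strat I O A')
    (m : forall k, seq (I k * O k) -> R) :
  (forall x, once (T x)) -> (forall k, complete (m k)) ->
  complete (fun u => \sum_(s <- expand T u) \prod_k m k (s k)).
Proof.
move=> onceT mC x; rewrite big_expand_nil -(sum_leaves_complete (onceT x)) //.
under eq_bigr do rewrite big_expand_seq1 big_histories big_mkcond /=.
rewrite exchange_big; apply: eq_bigr => p _.
by rewrite -big_mkcond (big_pred1 p.1) // => a; rewrite eq_sym.
Qed.

End Wiring.

(** * The moment functional of a wiring *)

Section WiredMoment.
Variables (R : rcfType) (Ob : nat -> nat -> Prop).
Variables (K : nat) (X A Y B : 'I_K -> finType).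
Variable M : forall k, seq (X k * A k) -> seq (Y k * B k) -> R.
Arguments M : clear implicits.
Variables (X' A' Y' B' : finType).
Variables (TA : X' -> strat X A A') (TB : Y' -> strat Y B B').

Definition wired_moment (u : seq (X' * A')) (v : seq (Y' * B')) : R :=
  \sum_(s <- expand TA u) \sum_(t <- expand TB v) \prod_k M k (s k) (t k).

Lemma wired_moment_exchange u v : wired_moment u v =
  \sum_(t <- expand TB v) \sum_(s <- expand TA u) \prod_k M k (s k) (t k).
Proof. exact: exchange_big. Qed.

Lemma sizes_in_expand u v s t k : s \in expand TA u -> t \in expand TB v ->
  sizes_in Ob (u, v) -> sizes_in Ob (s k, t k).
Proof.
move=> /(size_expand k) size_s /(size_expand k) size_t [m [n [Omn size_u size_v]]].
by exists m, n; split=> //=; [apply: leq_trans size_u|apply: leq_trans size_v].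
Qed.

Section Functional.
Hypothesis momM : forall k, moment_functional Ob (M k).

Lemma wired_moment_nil : wired_moment [::] [::] = 1.
Proof.
by rewrite /wired_moment !big_expand_nil big1 // => k _; apply: moment_nil (momM k).
Qed.

Lemma wired_moment_kernel p q : moment_kernel wired_moment p q =
  \sum_(s <- expand TA p.1) \sum_(t <- expand TB p.2)
    \sum_(s' <- expand TA q.1) \sum_(t' <- expand TB q.2)
      \prod_k moment_kernel (M k) (s k, t k) (s' k, t' k).
Proof.
rewrite /moment_kernel /wired_moment big_expand_cat; apply: eq_bigr => s _.
under eq_bigr do rewrite big_expand_cat.
rewrite exchange_big; apply: eq_bigr => t _.
rewrite big_expand_rev; apply: eq_bigr => s' _.
by rewrite big_expand_rev; apply: eq_bigr => t' _.
Qed.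

Lemma wired_moment_psd :
  psd_on (sizes_in Ob) (moment_kernel wired_moment).
Proof.
pose histories2 := ((forall k, seq (X k * A k)) * (forall k, seq (Y k * B k)))%type.
pose at_box k (p : histories2) := (p.1 k, p.2 k).
pose G (p q : histories2) := \prod_k moment_kernel (M k) (at_box k p) (at_box k q).
pose expand2 (p : seq (X' * A') * seq (Y' * B')) : seq histories2 :=
  [seq (s, t) | s <- expand TA p.1, t <- expand TB p.2].
have psdG : psd_on (fun p => forall k, sizes_in Ob (at_box k p)) G.
  apply: psd_on_prod => k.
    by move=> p q; apply: moment_kernel_sym (moment_rev (momM k)) _ _.
  by apply: (psd_on_comp (h := at_box k) _ (moment_psd (momM k))) => p; apply.
apply: eq_psd_on (psd_on_sum (e := expand2) _ psdG) => [p q _ _|[u v] uv_in].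
  rewrite wired_moment_kernel big_allpairs; apply: eq_bigr => s _.
  by apply: eq_bigr => t _; rewrite big_allpairs.
by move=> _ /allpairsP[[s t] [s_in t_in ->]] k; apply: sizes_in_expand s_in t_in uv_in.
Qed.

Hypotheses (onceA : forall x, once (TA x)) (onceB : forall y, once (TB y)).

Lemma wired_moment_functional : moment_functional Ob wired_moment.
Proof.
split; last exact: wired_moment_psd.
- move=> v; have -> : wired_moment^~ v = fun u =>
      \sum_(t <- expand TB v) \sum_(s <- expand TA u) \prod_k M k (s k) (t k).
    by apply/funext => u; apply: wired_moment_exchange.
  apply: projective_sum => t.
  by apply: (projective_expand onceA (m := fun k => (M k)^~ (t k))) => k; case: (momM k).
- move=> u; apply: projective_sum => s.
  by apply: (projective_expand onceB (m := fun k => M k (s k))) => k; case: (momM k).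
- move=> u v; rewrite /wired_moment big_expand_rev; apply: eq_bigr => s _.
  rewrite big_expand_rev; apply: eq_bigr => t _; apply: eq_bigr => k _.
  exact: moment_rev (momM k) _ _.
- exact: wired_moment_nil.
Qed.

End Functional.

Hypotheses (onceA : forall x, once (TA x)) (onceB : forall y, once (TB y)).
Hypothesis complM : forall k, moment_complete Ob (M k).

Lemma wired_moment_complete : moment_complete Ob wired_moment.
Proof.
split=> [v v_in|u u_in].
  apply: (eq_complete (fun u => esym (wired_moment_exchange u v))).
  apply: complete_sum => t t_in.
  apply: (complete_expand (m := fun k => (M k)^~ (t k)) onceA) => k.
  apply: (moment_completeA (complM k)).
  exact: (sizes_in_expand k (mem_expand_nil TA) t_in v_in).
apply: complete_sum => s s_in.
apply: (complete_expand (m := fun k => M k (s k)) onceB) => k.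
apply: (moment_completeB (complM k)).
exact: (sizes_in_expand k s_in (mem_expand_nil TB) u_in).
Qed.

End WiredMoment.

Lemma card_neq0_sum1 (R : numDomainType) (T : finType) (F : T -> R) :
  \sum_t F t = 1 -> #|T|%:R != 0 :> R.
Proof.
move=> sumF; rewrite pnatr_eq0; apply/negP => /eqP/card0_eq noT.
by have := oner_neq0 R; rewrite -sumF big_pred0 ?eqxx.
Qed.

Section BoxWeight.
Variables (R : realType) (X A Y B : finType) (P : X -> Y -> A -> B -> R).
Hypothesis boxP : is_box P.

Lemma margAE x y a : margA P x a = \sum_b P x y a b.
Proof.
have [[_ Y0 _] [_ nosig _]] := boxP; rewrite /margA.
under eq_bigr do rewrite (nosig x _ y).
by rewrite sumr_const -[X in _ * X]mulr_natl mulKf // pnatr_eq0 -lt0n.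
Qed.

Lemma margBE x y b : margB P y b = \sum_a P x y a b.
Proof.
have [[X0 _ _] [_ _ nosig]] := boxP; rewrite /margB.
under eq_bigr do rewrite (nosig _ x y).
by rewrite sumr_const -[X in _ * X]mulr_natl mulKf // pnatr_eq0 -lt0n.
Qed.

Lemma card_outcomesA_neq0 : #|A|%:R != 0 :> R.
Proof.
have [[/card_gt0P[x _] /card_gt0P[y _] _] [norm _ _]] := boxP.
exact: card_neq0_sum1 (norm x y).
Qed.

Lemma card_outcomesB_neq0 : #|B|%:R != 0 :> R.
Proof.
have [[/card_gt0P[x _] /card_gt0P[y _] _] [norm _ _]] := boxP.
by apply: card_neq0_sum1; rewrite -(norm x y) exchange_big.
Qed.

End BoxWeight.

Section WiredBox.
Variables (R : realType) (Ob : nat -> nat -> Prop).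
Hypotheses (Ob10 : Ob 1%N 0%N) (Ob01 : Ob 0%N 1%N).
Variables (K : nat) (X A Y B : 'I_K -> finType).
Variable P : forall k, X k -> Y k -> A k -> B k -> R.
Arguments P : clear implicits.
Variable M : forall k, seq (X k * A k) -> seq (Y k * B k) -> R.
Arguments M : clear implicits.
Hypothesis boxP : forall k, is_box (P k).
Hypothesis M_nil : forall k, M k [::] [::] = 1.
Hypothesis complM : forall k, moment_complete Ob (M k).
Hypothesis MP : forall k, represents (M k) (P k).

Lemma box_weight_ge0 k ox oy a b : 0 <= box_weight P (k := k) ox oy a b.
Proof.
have [[/card_gt0P[x0 _] /card_gt0P[y0 _] P_ge0] _] := boxP k.
case: ox oy => [x|] [y|] /=.
- exact: P_ge0.
- by rewrite (margAE (boxP k) x y0) divr_ge0 ?sumr_ge0.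
- by rewrite (margBE (boxP k) x0 y) divr_ge0 ?sumr_ge0.
- by rewrite invr_ge0 mulr_ge0.
Qed.

Lemma box_weight_marginal k u v : (size u <= 1)%N -> (size v <= 1)%N ->
  observed_marginal (fun ox a =>
    observed_marginal (fun oy b => box_weight P (k := k) ox oy a b) v) u = M k u v.
Proof.
have [[/card_gt0P[x0 _] /card_gt0P[y0 _] _] _] := boxP k.
have cardA := card_outcomesA_neq0 (boxP k); have cardB := card_outcomesB_neq0 (boxP k).
have sizesA x a : sizes_in Ob ([:: (x, a)] : seq (X k * A k), [::] : seq (Y k * B k)).
  by exists 1%N, 0%N.
have sizesB y b : sizes_in Ob ([::] : seq (X k * A k), [:: (y, b)] : seq (Y k * B k)).
  by exists 0%N, 1%N.
case: u => [|[x a] [|]] //; case: v => [|[y b] [|]] // _ _.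
- rewrite observed_marginal_nil; under eq_bigr do rewrite observed_marginal_nil.
  rewrite M_nil /= !sumr_const -mulrnA -[_ *+ _]mulr_natl natrM.
  by rewrite [X in X / _]mulrC mulfV // mulf_neq0.
- rewrite observed_marginal_nil; under eq_bigr do rewrite observed_marginal_seq1 /=.
  rewrite sumr_const -[_ *+ _]mulr_natl mulrC divfK // (margBE (boxP k) x0).
  by under eq_bigr do rewrite MP; apply: (moment_completeA (complM k)).
- rewrite observed_marginal_seq1 observed_marginal_nil /= sumr_const.
  rewrite -[_ *+ _]mulr_natl mulrC divfK // (margAE (boxP k) x y0).
  by under eq_bigr do rewrite MP; apply: (moment_completeB (complM k)).
- by rewrite !observed_marginal_seq1 /= MP.
Qed.

Variables (X' A' Y' B' : finType).
Variables (TA : X' -> strat X A A') (TB : Y' -> strat Y B B').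
Hypotheses (onceA : forall x, once (TA x)) (onceB : forall y, once (TB y)).

Lemma wired_represented : represents (wired_moment M TA TB) (wired P TA TB).
Proof.
move=> x y a b; pose weight k (oa : forall k, A k) oy ob :=
  box_weight P (input (TA x) oa k) oy (oa k) ob.
transitivity (\sum_(oa : {dffun forall k, A k} | result (TA x) oa == a)
    \sum_(t <- expand TB [:: (y, b)])
      \prod_k observed_marginal (weight k oa) (t k)).
  rewrite [RHS]big_mkcond; apply: eq_bigr => oa _.
  rewrite -(sum_outputs onceB y b (fun k => weight k oa)).
  by case: (_ == a); [rewrite /= -big_mkcond|rewrite /= big1].
rewrite exchange_big wired_moment_exchange big_seq [RHS]big_seq; apply: eq_bigr => t t_in.
rewrite (sum_outputs onceA x a (fun k ox oa =>
  observed_marginal (fun oy ob => box_weight P ox oy oa ob) (t k))).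
rewrite big_seq [RHS]big_seq; apply: eq_bigr => s s_in; apply: eq_bigr => k _.
by apply: box_weight_marginal; [apply: size_expand s_in|apply: size_expand t_in].
Qed.

Lemma wired_ge0 x y a b : 0 <= wired P TA TB x y a b.
Proof.
apply: sumr_ge0 => oa _; apply: sumr_ge0 => ob _; case: ifP => // _.
by apply: prodr_ge0 => k _; apply: box_weight_ge0.
Qed.

End WiredBox.

Theorem theorem4 (R : realType) (Ob : nat -> nat -> Prop) :
  Ob 1%N 0%N -> Ob 0%N 1%N ->
  closed_under_wirings (fun X A Y B : finType => @O_positive R X A Y B Ob).
Proof.
move=> Ob10 Ob01 K X A Y B P posP X' A' Y' B' X'0 Y'0 TA TB onceA onceB.
have boxM k := (O_positiveP Ob10 Ob01 (P k)).1 (posP k).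
have boxP k : is_box (P k) := (boxM k).1.
have [M momM MP] := all_sig2 (fun k => cid2 (boxM k).2).
have complM k : moment_complete Ob (M k).
  have [[/card_gt0P[x0 _] /card_gt0P[y0 _] _] [norm _ _]] := boxP k.
  apply: (moment_functional_complete Ob10 Ob01 (momM k) x0 y0) => x y; rewrite -(norm x y).
  by apply: eq_bigr => a _; apply: eq_bigr => b _; rewrite MP.
have M_nil k : M k [::] [::] = 1 := moment_nil (momM k).
have repr := wired_represented Ob10 Ob01 boxP M_nil complM MP onceA onceB.
apply/(O_positiveP Ob10 Ob01); split.
  apply: (is_box_moment Ob10 Ob01 X'0 Y'0 _ repr).
  - exact: wired_ge0.
  - exact: wired_moment_nil momM.
  - exact: wired_moment_complete.
by exists (wired_moment M TA TB) => //; apply: wired_moment_functional.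
Qed.
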